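(* Let $n\leq 4$, $r\geq 1$ and $q\geq 3$. Then $n$ prisoners have a winning strategy in the prisoners-and-rooms game with $r$ rooms and $q$ states, for any known initial configuration of room states.
   Context: The game: there are $n$ prisoners and $r$ rooms; each room contains a switch that is in one of $q$ states $\{0,1,\ldots,q-1\}$. The initial state of every room is known to the prisoners. A warden leads prisoners into rooms one at a time according to a schedule, i.e. an infinite sequence of (prisoner, room) pairs; a schedule is valid if every prisoner visits every room infinitely often. The rooms are indistinguishable to the prisoners, and prisoners have no information about time or other visits: on each visit a prisoner observes only the current state of the room, may change it to any state, and may declare that all prisoners have visited all rooms. A (deterministic) strategy assigns to each prisoner a rule determining, from the sequence of states that prisoner has observed so far (and their own previous actions), what new state to set and whether to declare. A strategy is winning if for every valid schedule some prisoner eventually declares, and every declaration is made only at a time when every prisoner has already visited every room. Strategies may differ between prisoners. *)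

(* Defs.v *)
From mathcomp Require Import all_boot.
Set Implicit Arguments. Unset Strict Implicit. Unset Printing Implicit Defensive.

(* A (deterministic) strategy: for each prisoner, a rule mapping the sequence
   of states that prisoner has observed so far (oldest first, the last entry
   being the state observed on the current visit) to the new state to set and
   whether to declare.  The prisoner's own previous actions are determined by
   the earlier observations, so they need not be passed separately.
   Strategies may differ between prisoners. *)
Definition strategy (n q : nat) := 'I_n -> seq 'I_q -> 'I_q * bool.

Definition schedule (n r : nat) := nat -> 'I_n * 'I_r.

Definition valid_schedule (n r : nat) (sched : schedule n r) : Prop :=
  forall (p : 'I_n) (k : 'I_r) (t : nat), exists2 t', t <= t' & sched t' = (p, k).

Definition config (n r q : nat) := (('I_r -> 'I_q) * ('I_n -> seq 'I_q))%type.

Definition step (n r q : nat) (strat : strategy n q) (c : config n r q)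
    (v : 'I_n * 'I_r) : config n r q :=
  let: (p, k) := v in
  let h := rcons (c.2 p) (c.1 k) in
  let a := strat p h in
  ((fun k' => if k' == k then a.1 else c.1 k'),
   (fun p' => if p' == p then h else c.2 p')).

(* Configuration before the visit at time t. *)
Fixpoint run (n r q : nat) (strat : strategy n q) (sched : schedule n r)
    (init : 'I_r -> 'I_q) (t : nat) : config n r q :=
  match t with
  | 0 => (init, fun _ => [::])
  | t'.+1 => step strat (run strat sched init t') (sched t')
  end.

Definition declares (n r q : nat) (strat : strategy n q) (sched : schedule n r)
    (init : 'I_r -> 'I_q) (t : nat) : bool :=
  let: (p, k) := sched t in
  let c := run strat sched init t in
  (strat p (rcons (c.2 p) (c.1 k))).2.

Definition all_visited (n r : nat) (sched : schedule n r) (t : nat) : Prop :=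
  forall (p : 'I_n) (k : 'I_r), exists2 t', t' <= t & sched t' = (p, k).

Definition winning (n r q : nat) (init : 'I_r -> 'I_q) (strat : strategy n q) : Prop :=
  forall sched : schedule n r, valid_schedule sched ->
    (exists t, declares strat sched init t) /\
    (forall t, declares strat sched init t -> all_visited sched t).

(* Main.v *)
Require Import Defs.
From mathcomp Require Import all_boot.
From Stdlib Require Import FunctionalExtensionality Classical_Prop.
From mathcomp Require Import zify.
Set Implicit Arguments. Unset Strict Implicit. Unset Printing Implicit Defensive.

(**
Three states a, b, c suffice.  First a leader brings all rooms to state a, using
only moves between a and b after removing the other states.  Meanwhile every other
prisoner makes r + 1 moves b -> a; completing them takes more b's than there
were initially, so it proves that the leader has removed the other states, and the
leader recognizes from the number of its own moves a -> b that everyone is done.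
From then on the appearance of c is a signal.

With at least three rooms, the prisoners then work one at a time, all others being
passive: the active one changes the state of every room, counting its moves, and
finally leaves the rooms in a constant configuration whose set of states tells the
next prisoner to start.  The sets of states seen during the successive stages are
{a,b}, {a,c}, {a,b}, {b,c}, {a,b}, {a,b,c}, and the words c, cbc, cbcac cannot be
read before the stages {a,c}, {b,c}, {a,b,c}, respectively, but are always read
eventually if the configuration remains constant there.  The configuration
{a,b,c} needs three rooms; with one or two rooms a prisoner that has read c and
then a has already been everywhere, and acknowledgments to the leader suffice.
*)

(** * Protocols of terminating roles *)

Definition upd (I : eqType) (A : Type) (f : I -> A) (i : I) (y : A) : I -> A :=
  fun j => if j == i then y else f j.

Lemma upd_same (I : eqType) (A : Type) (f : I -> A) i y : upd f i y i = y.
Proof. by rewrite /upd eqxx. Qed.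

Lemma upd_other (I : eqType) (A : Type) (f : I -> A) i j y :
  j != i -> upd f i y j = f j.
Proof. by rewrite /upd => /negPf ->. Qed.

Lemma upd_id (I : eqType) (A : Type) (f : I -> A) i : upd f i (f i) = f.
Proof. by apply: functional_extensionality => j; rewrite /upd; case: eqP => // ->. Qed.

Lemma upd_upd (I : eqType) (A : Type) (f : I -> A) i x y :
  upd (upd f i x) i y = upd f i y.
Proof. by apply: functional_extensionality => j; rewrite /upd; case: eqP. Qed.

Lemma sum_upd (I : finType) (A : Type) (F : A -> nat) (f : I -> A) i y :
  \sum_j F (upd f i y j) + F (f i) = \sum_j F (f j) + F y.
Proof.
rewrite (bigD1 i) //= [in RHS](bigD1 i) //= upd_same.
under eq_bigr => j ji do rewrite upd_other //.
lia.
Qed.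

(* A protocol is written for [N] roles; prisoner [p] plays all the roles [i] with
   [role_of i = p], one after the other on each visit, so that one protocol for
   four roles serves every number of prisoners up to four.  [tr i s x = None]
   means that role [i] in memory state [s] ignores a room in state [x], and
   [V i k] records that role [i] has been in room [k].  As every effective move
   decreases [mu], the run becomes constant, and liveness reduces to [stable_fin]. *)
Record progress_invariant (N r q : nat) (S : Type)
    (tr : 'I_N -> S -> 'I_q -> option (S * 'I_q)) (fin : S -> bool) (mu : S -> nat)
    (Inv : ('I_r -> 'I_q) -> ('I_N -> S) -> ('I_N -> 'I_r -> Prop) -> Prop) : Prop := {
  mu_decr : forall i s x s' y, tr i s x = Some (s', y) -> mu s' < mu s;
  Inv_mono : forall f s (V V' : 'I_N -> 'I_r -> Prop),
    (forall i k, V i k -> V' i k) -> Inv f s V -> Inv f s V';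
  Inv_step : forall f s (V : 'I_N -> 'I_r -> Prop) i k s' y,
    Inv f s V -> V i k -> tr i (s i) (f k) = Some (s', y) ->
    Inv (upd f k y) (upd s i s') V;
  stable_fin : forall f s V, Inv f s V ->
    (forall i k, tr i (s i) (f k) = None) -> exists i, fin (s i);
  fin_visited : forall f s V i, Inv f s V -> fin (s i) -> forall j k, V j k
}.

Section Roles.
Variables (N n r q : nat) (S : Type).
Variable tr : 'I_N -> S -> 'I_q -> option (S * 'I_q).
Variable s0 : 'I_N -> S.
Variable fin : S -> bool.
Variable mu : S -> nat.
Variable x0 : 'I_q.
Variable role_of : 'I_N -> 'I_n.
Variable Inv : ('I_r -> 'I_q) -> ('I_N -> S) -> ('I_N -> 'I_r -> Prop) -> Prop.
Hypothesis invP : progress_invariant tr fin mu Inv.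

Definition role_step (i : 'I_N) (c : ('I_N -> S) * 'I_q) : ('I_N -> S) * 'I_q :=
  if tr i (c.1 i) c.2 is Some sy then (upd c.1 i sy.1, sy.2) else c.

Definition roles_step (l : seq 'I_N) c := foldl (fun c i => role_step i c) c l.

Definition roles (p : 'I_n) : seq 'I_N := [seq i <- enum 'I_N | role_of i == p].

(** The simulation carries the memories of all roles, but only the entries of the roles of [p] are
    meaningful. [x0] is returned on the empty history only, which no visit presents. *)
Definition play (p : 'I_n) (h : seq 'I_q) : ('I_N -> S) * 'I_q :=
  foldl (fun c x => roles_step (roles p) (c.1, x)) (s0, x0) h.

Definition role_strategy : strategy n q := fun p h =>
  let c := play p h in (c.2, has (fun i => fin (c.1 i)) (roles p)).

Definition total (s : 'I_N -> S) := \sum_i mu (s i).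

Lemma total_upd s i s' : total (upd s i s') + mu (s i) = total s + mu s'.
Proof. exact: sum_upd. Qed.

Lemma role_step_total i c : total (role_step i c).1 <= total c.1.
Proof.
rewrite /role_step; case E: (tr _ _ _) => [[s' y]|] //=.
have := total_upd c.1 i s'; have := mu_decr invP E; lia.
Qed.

Lemma roles_step_total l c : total (roles_step l c).1 <= total c.1.
Proof.
elim: l c => //= i l IH c.
by apply: leq_trans (IH _) (role_step_total _ _).
Qed.

(** Every move lowers [total] strictly, so an unchanged total means that no role moved. *)
Lemma roles_step_stable l c : total (roles_step l c).1 = total c.1 ->
  roles_step l c = c /\ forall i, i \in l -> tr i (c.1 i) c.2 = None.
Proof.
elim: l c => //= i l IH c Ht.
have H1 := roles_step_total l (role_step i c).
have : tr i (c.1 i) c.2 = None.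
  move: Ht H1; rewrite /role_step; case E: (tr _ _ _) => [[s' y]|] //= -> H1.
  have := total_upd c.1 i s'; have := mu_decr invP E; lia.
move=> E; have Ec: role_step i c = c by rewrite /role_step E.
rewrite Ec in Ht *; have [-> H] := IH _ Ht; split=> // j.
by rewrite inE => /predU1P [->|/H].
Qed.

(** This lets the private simulations be glued into one global memory: the moves of the roles in [l]
    do not depend on the other entries. *)
Lemma roles_step_local l s s' x : (forall i, i \in l -> s i = s' i) ->
  [/\ (roles_step l (s, x)).2 = (roles_step l (s', x)).2,
      forall i, i \in l -> (roles_step l (s, x)).1 i = (roles_step l (s', x)).1 i
    & forall i, i \notin l -> (roles_step l (s, x)).1 i = s i].
Proof.
have gen l' : {subset l' <= l} ->
    forall c c', c.2 = c'.2 -> (forall i, i \in l -> c.1 i = c'.1 i) ->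
  [/\ (roles_step l' c).2 = (roles_step l' c').2,
      forall i, i \in l -> (roles_step l' c).1 i = (roles_step l' c').1 i
    & forall i, i \notin l -> (roles_step l' c).1 i = c.1 i].
  elim: l' => [|j l' IH] sub c c' E2 E1 //=.
  have jl : j \in l by apply: sub; rewrite inE eqxx.
  have sub' : {subset l' <= l} by move=> k kl; apply: sub; rewrite inE kl orbT.
  have [||A B C] := IH sub' (role_step j c) (role_step j c').
  - by rewrite /role_step E2 E1 //; case: (tr _ _ _).
  - move=> i il; rewrite /role_step E2 E1 //; case: (tr _ _ _) => [[t y]|] /=; last exact: E1.
    by rewrite /upd; case: eqP => // _; apply: E1.
  split=> // i il; rewrite C //.
  rewrite /role_step; case: (tr _ _ _) => [[t y]|] //=.
  by rewrite upd_other //; apply: contraNneq il => ->.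
by move=> E; apply: gen.
Qed.

Lemma Inv_roles_step l f s V k x : Inv (upd f k x) s V ->
  (forall i, i \in l -> V i k) ->
  Inv (upd f k (roles_step l (s, x)).2) (roles_step l (s, x)).1 V.
Proof.
elim: l s x => //= i l IH s x H Hl.
have Vi : V i k by apply: Hl; rewrite inE eqxx.
have Hl' j : j \in l -> V j k by move=> jl; apply: Hl; rewrite inE jl orbT.
rewrite /role_step /=; case E: (tr _ _ _) => [[s' y]|] /=; last exact: IH.
apply: IH => //.
by rewrite -(upd_upd f k x); apply: (Inv_step invP) H Vi _; rewrite upd_same.
Qed.

Variable init : 'I_r -> 'I_q.
Hypothesis Inv_init : Inv init s0 (fun _ _ => False).
Hypothesis role_of_surj : forall p, exists i, role_of i = p.

Lemma mem_roles p i : (i \in roles p) = (role_of i == p).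
Proof. by rewrite mem_filter mem_enum andbT. Qed.

Lemma play_rcons p h x :
  play p (rcons h x) = roles_step (roles p) ((play p h).1, x).
Proof. by rewrite /play -cats1 foldl_cat. Qed.

(** * Runs of the strategy: safety and liveness *)

Section Run.
Variable sched : schedule n r.
Let cfg t := run role_strategy sched init t.
Let rooms t := (cfg t).1.
Let sts t : 'I_N -> S := fun i => (play (role_of i) ((cfg t).2 (role_of i))).1 i.
Let vis t : 'I_N -> 'I_r -> Prop := fun i k => exists2 t', t' < t & sched t' = (role_of i, k).

Lemma run_step t : let p := (sched t).1 in let k := (sched t).2 in
  let c := roles_step (roles p) (sts t, rooms t k) in
  [/\ rooms t.+1 = upd (rooms t) k c.2, sts t.+1 = c.1 &
      declares role_strategy sched init t = has (fun i => fin (c.1 i)) (roles p)].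
Proof.
rewrite /rooms /sts /declares /cfg /=; case: (sched t) => p k /=.
set c := run _ _ _ _.
have [|A B C] := @roles_step_local (roles p)
  (fun i => (play (role_of i) (c.2 (role_of i))).1 i) (play p (c.2 p)).1 (c.1 k).
  by move=> i; rewrite mem_roles => /eqP ->.
rewrite !play_rcons A; split=> //.
  apply: functional_extensionality => i.
  have [E|E] := eqVneq (role_of i) p; last by rewrite C // mem_roles.
  by rewrite E play_rcons B // mem_roles E.
by apply: eq_in_has => i il; rewrite B.
Qed.

Lemma Inv_run t : Inv (rooms t) (sts t) (vis t).
Proof.
elim: t => [|t IH]; first by apply: (Inv_mono invP) Inv_init.
have [-> -> _] := run_step t.
apply: Inv_roles_step.
  rewrite upd_id; apply: (Inv_mono invP) IH => i k [t' lt e]; exists t' => //; lia.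
move=> i; rewrite mem_roles => /eqP Ei; exists t => //.
by rewrite Ei; case: (sched t).
Qed.

Lemma declares_all_visited t :
  declares role_strategy sched init t -> all_visited sched t.
Proof.
have [_ E ->] := run_step t; rewrite -E => /hasP [i _ fi] p k.
have [j <-] := role_of_surj p.
(* The declaration is decided by the memory after visit [t], and the visits strictly before [t.+1]
   are those up to [t]. *)
have [t' lt e] := fin_visited invP (Inv_run t.+1) fi j k.
by exists t'.
Qed.

Hypothesis sched_valid : valid_schedule sched.

Lemma total_const : exists T, forall t, T <= t -> total (sts t) = total (sts T).
Proof.
have mono t t' : t <= t' -> total (sts t') <= total (sts t).
  elim: t' => [|t' IH]; first by rewrite leqn0 => /eqP ->.
  rewrite leq_eqVlt => /predU1P [-> //|/IH]; apply: leq_trans.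
  by have [_ -> _] := run_step t'; apply: leq_trans (roles_step_total _ _) _.
suff gen m : forall T, total (sts T) <= m ->
    exists T, forall t, T <= t -> total (sts t) = total (sts T) by exact: (gen _ 0 (leqnn _)).
elim: m => [|m IH] T HT.
  by exists T => t /mono; lia.
case: (classic (exists2 t, T <= t & total (sts t) < total (sts T))) => [[t _ lt]|no].
  by apply: (IH t); lia.
exists T => t Tt; apply/eqP; rewrite eqn_leq mono //=.
by rewrite leqNgt; apply/negP => lt; apply: no; exists t.
Qed.

(** Once [total] is constant nothing changes any more; since every role still reaches every room,
    [tr] must be [None] everywhere, and [stable_fin] applies. *)
Lemma eventually_declares : exists t, declares role_strategy sched init t.
Proof.
have [T HT] := total_const.
have stab t : T <= t -> rooms t = rooms T /\ sts t = sts T.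
  elim: t => [|t IH]; first by rewrite leqn0 => /eqP ->.
  rewrite leq_eqVlt => /predU1P [<- //|lt].
  have {IH} [E1 E2] := IH lt.
  have [A B _] := run_step t.
  have [|C _] := @roles_step_stable (roles (sched t).1) (sts t, rooms t (sched t).2).
    by rewrite -B /= (HT t.+1) ?(HT t) //; lia.
  by rewrite A B C /= upd_id.
have none i k : tr i (sts T i) (rooms T k) = None.
  have [t Tt e] := sched_valid (role_of i) k T.
  have [E1 E2] := stab t Tt.
  have [_ B _] := run_step t.
  have [|_] := @roles_step_stable (roles (sched t).1) (sts t, rooms t (sched t).2).
    by rewrite -B /= (HT t.+1) ?(HT t) //; lia.
  by rewrite e /= E1 E2; apply; rewrite mem_roles.
have [i fi] := stable_fin invP (Inv_run T) none.
(* Any room serves here; the first visit supplies one. *)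
have [t Tt e] := sched_valid (role_of i) (sched 0).2 T.
exists t; have [_ B ->] := run_step t.
apply/hasP; exists i; first by rewrite mem_roles e.
by rewrite -B; have [_ ->] := stab t.+1 (leqW Tt).
Qed.

End Run.

Theorem role_strategy_winning : winning init role_strategy.
Proof.
move=> sched valid; split; first exact: eventually_declares.
by move=> t; apply: declares_all_visited.
Qed.

End Roles.

(** * Counting the rooms in given states *)

Section Counting.
Variables (r q : nat).
Implicit Types (P : 'I_q -> bool) (f : 'I_r -> 'I_q).

Definition cnt P f : nat := \sum_k (P (f k) : nat).
Definition num (x : 'I_q) f : nat := cnt (fun y => y == x) f.

Lemma cnt_upd P f k y : cnt P (upd f k y) + P (f k) = cnt P f + P y.
Proof. exact: (sum_upd (fun x => P x : nat)). Qed.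

Lemma cnt_gt0 P f : 0 < cnt P f -> exists k, P (f k).
Proof.
rewrite lt0n sum_nat_eq0 negb_forall => /existsP [k].
by rewrite /= eqb0 negbK; exists k.
Qed.

Lemma cnt_eq0 P f : cnt P f = 0 -> forall k, P (f k) = false.
Proof.
by move/eqP; rewrite sum_nat_eq0 => /forallP H k; have /= := H k; rewrite eqb0 => /negPf.
Qed.

Lemma cnt_full P f : cnt P f = r -> forall k, P (f k).
Proof.
move=> E k; apply/negbFE/(@cnt_eq0 (fun x => ~~ P x)).
have : cnt P f + cnt (fun x => ~~ P x) f = r.
  rewrite /cnt -big_split /= -[RHS]card_ord -sum1_card; apply: eq_bigr => i _.
  by case: (P _).
lia.
Qed.

Lemma cnt_le P f : cnt P f <= r.
Proof.
rewrite /cnt -[r in _ <= r]card_ord -sum1_card; apply: leq_sum => i _.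
by case: (P _).
Qed.

Lemma num_upd x f k y : num x (upd f k y) + (f k == x) = num x f + (y == x).
Proof. exact: cnt_upd. Qed.

Lemma num_gt0 x f : 0 < num x f -> exists k, f k = x.
Proof. by case/cnt_gt0 => k /eqP; exists k. Qed.

Lemma num_eq0 x f : num x f = 0 -> forall k, (f k == x) = false.
Proof. exact: cnt_eq0. Qed.

Lemma num_full x f : num x f = r -> forall k, f k = x.
Proof. by move=> H k; apply/eqP; apply: (cnt_full H). Qed.

Lemma num_all x f : (forall k, f k = x) -> num x f = r.
Proof.
move=> H; rewrite /num /cnt -[RHS]card_ord -sum1_card; apply: eq_bigr => k _.
by rewrite H eqxx.
Qed.

Lemma num_le x f : num x f <= r.
Proof. exact: cnt_le. Qed.

End Counting.

Lemma le_sum1 (I : finType) (F : I -> nat) i : F i <= \sum_j F j.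
Proof. by rewrite (bigD1 i) //= leq_addr. Qed.

Lemma le_sum2 (I : finType) (F : I -> nat) i j : i != j -> F i + F j <= \sum_k F k.
Proof.
by move=> ij; rewrite (bigD1 i) //= (bigD1 j) 1?eq_sym //= addnA leq_addr.
Qed.

(** * Synchronization: from an arbitrary known configuration to all rooms a *)

Section Sync.
Variables (N r q : nat) (S : Type).
Variable tr : 'I_N.+1 -> S -> 'I_q -> option (S * 'I_q).
Variable s0 : 'I_N.+1 -> S.
Variable fin : S -> bool.
Variable mu : S -> nat.
Variables a b : 'I_q.
Hypothesis ab : a != b.
Hypothesis r_gt0 : 0 < r.
Variable Inv : ('I_r -> 'I_q) -> ('I_N.+1 -> S) -> ('I_N.+1 -> 'I_r -> Prop) -> Prop.
Hypothesis invP : progress_invariant tr fin mu Inv.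
Hypothesis Inv_init : forall f (V : 'I_N.+1 -> 'I_r -> Prop),
  (forall k, f k = a) -> (forall k, V ord0 k) -> Inv f s0 V.
(** A nonleader may finish its synchronizing moves while the leader still moves rooms between a and
    b; it must not start the main protocol then. *)
Hypothesis idle0 : forall i x, i != ord0 -> (x == a) || (x == b) -> tr i (s0 i) x = None.
Hypothesis fin0 : forall i, fin (s0 i) = false.

Definition sync_state := (nat * nat * nat * S)%type.
Definition cm (st : sync_state) := st.1.1.1.
Definition cu (st : sync_state) := st.1.1.2.
Definition cv (st : sync_state) := st.1.2.

Definition other (x : 'I_q) : bool := (x != a) && (x != b).

(* The memory [(m, u, v, t)] consists of the numbers of remaining moves other -> a,
   a -> b and b -> a, to be made in this order, and of the state [t] of the main
   protocol that follows.  The leader makes all three kinds of moves, the other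
   roles only [r.+1] moves b -> a each. *)
Definition sync_tr (i : 'I_N.+1) (st : sync_state) (x : 'I_q) : option (sync_state * 'I_q) :=
  let: (m, u, v, t) := st in
  if 0 < m then if other x then Some ((m.-1, u, v, t), a) else None
  else if 0 < u then if x == a then Some ((0, u.-1, v, t), b) else None
  else if 0 < v then if x == b then Some ((0, 0, v.-1, t), a) else None
  else omap (fun ty => ((0, 0, 0, ty.1), ty.2)) (tr i t x).

Definition sync_mu (st : sync_state) := cm st + cu st + cv st + mu st.2.
Definition sync_fin (st : sync_state) := (st.1 == (0, 0, 0)) && fin st.2.

Variable init : 'I_r -> 'I_q.

Definition v0 (i : 'I_N.+1) : nat := if i == ord0 then r else r.+1.
(** The initial b's and those produced by the leader together match the b -> a moves of all roles;
    [sum_v0_ge] excludes truncation. *)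
Definition u0 : nat := \sum_i v0 i - num b init.
Definition sync_s0 (i : 'I_N.+1) : sync_state :=
  if i == ord0 then (cnt other init, u0, v0 i, s0 i) else (0, 0, v0 i, s0 i).

(* The last equation forces [cv (s i) = 0] for every nonleader [i], and all rooms
   to be b, once the leader has no a -> b move left while [cv (s ord0) = r]. *)
Definition sync_base (f : 'I_r -> 'I_q) (s : 'I_N.+1 -> sync_state) :=
  [/\ forall i, (s i).2 = s0 i /\ cv (s i) <= v0 i,
      forall i, i != ord0 -> (s i).1.1 = (0, 0),
      cnt other f = cm (s ord0)
    & num b f + cu (s ord0) = \sum_i cv (s i)].

(** The three phases: in A the leader removes the other states and produces b's; in B, all rooms
    having been b, it turns them back to a; in C the main protocol runs. The last clause of B
    ensures that the leader has been everywhere when C begins. *)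
Definition sync_A f s :=
  [/\ sync_base f s, cv (s ord0) = r & 0 < cm (s ord0) -> cu (s ord0) = u0].

Definition sync_B f s (V : 'I_N.+1 -> 'I_r -> Prop) :=
  [/\ sync_base f s, (s ord0).1.1 = (0, 0), forall i, i != ord0 -> cv (s i) = 0
    & forall k, f k = a -> V ord0 k].

Definition sync_C f (s : 'I_N.+1 -> sync_state) V :=
  (forall i, (s i).1 = (0, 0, 0)) /\ Inv f (fun i => (s i).2) V.

Definition sync_Inv f s V := [\/ sync_A f s, sync_B f s V | sync_C f s V].

Lemma sync_mu_decr i s x s' y : sync_tr i s x = Some (s', y) -> sync_mu s' < sync_mu s.
Proof.
move: s => [[[m u] v] t]; rewrite /sync_tr /sync_mu /cm /cu /cv.
case: ltnP => [m0|_]; first by case: ifP => // _ [<- _] /=; lia.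
case: ltnP => [m0|_]; first by case: ifP => // _ [<- _] /=; lia.
case: ltnP => [m0|_]; first by case: ifP => // _ [<- _] /=; lia.
by case E: (tr _ _ _) => [[t' y']|] //= [<- _] /=; have := mu_decr invP E; lia.
Qed.

Lemma v0_le i : r <= v0 i.
Proof. by rewrite /v0; case: ifP; lia. Qed.

Lemma sum_v0_ge : r <= \sum_i v0 i.
Proof. exact: leq_trans (v0_le ord0) (le_sum1 v0 _). Qed.

Lemma A_to_B f s V : sync_A f s -> (s ord0).1.1 = (0, 0) -> sync_B f s V.
Proof.
move=> [base v _] E; split=> //.
  move=> i i0; case: base => _ _ _; rewrite {1}/cu E /= => H.
  have := le_sum2 (fun i => cv (s i)) i0; rewrite -H v.
  by have := num_le b f; lia.
move=> k fk; case: base => _ _ _; rewrite {1}/cu E /= => H.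
have := le_sum1 (fun i => cv (s i)) ord0; rewrite -H v => {}H.
have /num_full /(_ k) : num b f = r by have := num_le b f; lia.
by move/eqP; rewrite fk (negbTE ab).
Qed.

Lemma B_to_C f s V : sync_B f s V -> cv (s ord0) = 0 -> sync_C f s V.
Proof.
move=> [[s2 s11 o sumv] E others vis] v.
have zero i : (s i).1 = (0, 0, 0).
  have [->|i0] := eqVneq i ord0; first by move: E v; rewrite /cv; case: (s ord0) => [[[? ?] ?] ?] /= [-> ->] ->.
  by move: (s11 i i0) (others i i0); rewrite /cv; case: (s i) => [[[? ?] ?] ?] /= [-> ->] ->.
split=> //.
have -> : (fun i => (s i).2) = s0 by apply: functional_extensionality => i; case: (s2 i).
have allA k : f k = a.
  have /num_eq0 /(_ k) : num b f = 0.
    suff : \sum_i cv (s i) = 0 by lia.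
    by rewrite big1 // => i _; rewrite /cv zero.
  move: o; rewrite /cm E /= => /cnt_eq0 /(_ k).
  by move=> + fb; rewrite /other fb andbT; case: eqP.
by apply: Inv_init => // k; apply: vis.
Qed.

(** Phases overlap at their boundaries; choosing the latest one leaves the leader with remaining
    moves of the right kind in A and in B. *)
Lemma sync_Inv_cases f s V : sync_Inv f s V ->
  [\/ sync_A f s /\ (s ord0).1.1 <> (0, 0), sync_B f s V /\ 0 < cv (s ord0) | sync_C f s V].
Proof.
have B : sync_B f s V -> [\/ sync_A f s /\ (s ord0).1.1 <> (0, 0),
    sync_B f s V /\ 0 < cv (s ord0) | sync_C f s V].
  move=> HB; case: (posnP (cv (s ord0))) => E; last by constructor 2.
  by constructor 3; apply: B_to_C.
case=> [HA|//|HC]; last by constructor 3.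
case: (eqVneq (s ord0).1.1 (0, 0)) => [E|/eqP E]; last by constructor 1.
by apply: B; apply: A_to_B.
Qed.

Lemma sync_Inv_mono f s (V V' : 'I_N.+1 -> 'I_r -> Prop) :
  (forall i k, V i k -> V' i k) -> sync_Inv f s V -> sync_Inv f s V'.
Proof.
move=> sub [HA|[? ? ? H]|[? H]]; [constructor 1|constructor 2|constructor 3] => //.
  by split=> // k /H /sub.
by split=> //; apply: (Inv_mono invP) H.
Qed.

(* Before the leader starts to produce b's, at most [r] of them can be consumed. *)
Lemma A_early f s i : sync_A f s -> 0 < cm (s ord0) -> i != ord0 -> 0 < cv (s i).
Proof.
move=> [[s2 _ _ sumv] _ H] m i0; rewrite lt0n; apply/eqP => vi.
(* [w] undoes the moves of [i] and is still bounded by [v0]; so [i] alone would have consumed [r.+1]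
   b's. *)
set w := upd (fun i => cv (s i)) i r.+1.
have E : \sum_j w j + cv (s i) = \sum_j cv (s j) + r.+1 by exact: (sum_upd id).
have : \sum_j w j <= \sum_j v0 j.
  apply: leq_sum => j _; rewrite /w /upd; case: eqP => [->|_]; first by rewrite /v0 (negbTE i0).
  by case: (s2 j).
have := num_le b init; have := sum_v0_ge.
by move: sumv; rewrite (H m) /u0; lia.
Qed.

Lemma cnt_other0 (f : 'I_r -> 'I_q) : cnt other f = 0 -> forall k, (f k == a) || (f k == b).
Proof. by move/cnt_eq0 => H k; have := H k; rewrite /other; do 2 case: eqP. Qed.

Lemma sync_base_upd f s i k y m u v :
  sync_base f s -> v <= v0 i -> (i != ord0 -> (m, u) = (0, 0)) ->
  let s' := upd s i (m, u, v, (s i).2) in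
  cnt other (upd f k y) = cm (s' ord0) ->
  num b (upd f k y) + cu (s' ord0) + cv (s i) = \sum_j cv (s j) + v ->
  sync_base (upd f k y) s'.
Proof.
move=> [s2 s11 _ _] vle mu0 s' Ho Hb; split=> //.
- by move=> j; rewrite /s' /upd; case: eqP => [->|_]; [case: (s2 i)|].
- by move=> j j0; rewrite /s' /upd; case: eqP => [ji|_]; [rewrite mu0 // -ji|apply: s11].
- have : \sum_j cv (s' j) + cv (s i) = \sum_j cv (s j) + v by exact: sum_upd.
  lia.
Qed.

Lemma sync_tr_inv i st x st' y : sync_tr i st x = Some (st', y) ->
  [\/ [/\ 0 < cm st, other x, y = a & st' = ((cm st).-1, cu st, cv st, st.2)],
      [/\ cm st = 0, 0 < cu st, x = a, y = b & st' = (0, (cu st).-1, cv st, st.2)],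
      [/\ st.1.1 = (0, 0), 0 < cv st, x = b, y = a & st' = (0, 0, (cv st).-1, st.2)]
    | st.1 = (0, 0, 0) /\ exists2 t, tr i st.2 x = Some (t, y) & st' = (0, 0, 0, t)].
Proof.
move: st => [[[m u] v] t]; rewrite /sync_tr /cm /cu /cv /=.
case: posnP => [->|m0]; last by case: ifP => // ox [<- <-]; constructor 1.
case: posnP => [->|u_gt0]; last by case: eqP => // -> [<- <-]; constructor 2.
case: posnP => [->|v_gt0]; last by case: eqP => // -> [<- <-]; constructor 3.
case E: (tr _ _ _) => [[t' y']|] //= [<- <-]; constructor 4; split=> //.
by exists t'.
Qed.

Lemma sync_Inv_step f s (V : 'I_N.+1 -> 'I_r -> Prop) i k s' y :
  sync_Inv f s V -> V i k -> sync_tr i (s i) (f k) = Some (s', y) ->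
  sync_Inv (upd f k y) (upd s i s') V.
Proof.
move=> HI Vik /sync_tr_inv tri.
have oth_a : other a = false by rewrite /other eqxx.
have oth_b : other b = false by rewrite /other eqxx andbF.
have Ho := cnt_upd other f k y; have Hb := num_upd b f k y.
case/sync_Inv_cases: HI => [[HA nz]|[HB pos]|[z HI]].
- have [base vr uE] := HA; have [s2 s11 o sumv] := base.
  have [si2 vle] := s2 i.
  case: tri => [[m ox ey es]|[m u ex ey es]|[mu0 v ex ey es]|[z [t Et es]]].
  + have i0 : i = ord0.
      by apply/eqP/negPn/negP => /s11; move: m; rewrite /cm => + E; rewrite E.
    subst i; constructor 1; split.
    * rewrite es; apply: sync_base_upd => //; rewrite upd_same /cm /cu /cv /= -/(cm _) -/(cu _) -/(cv _).
        by move: Ho; rewrite ey ox oth_a; lia.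
      move: Hb ox; rewrite ey (negbTE ab) /other => + /andP [_ /negPf fb].
      by rewrite fb -sumv; lia.
    * by rewrite upd_same es.
    * by rewrite upd_same es /cm /cu /= => _; apply: uE.
  + have i0 : i = ord0.
      by apply/eqP/negPn/negP => /s11; move: u; rewrite /cu => + E; rewrite E.
    subst i; constructor 1; split.
    * rewrite es; apply: sync_base_upd => //; rewrite upd_same /cm /cu /cv /= -/(cm _) -/(cu _) -/(cv _).
        by move: Ho; rewrite ey ex oth_a oth_b o m; lia.
      by move: Hb; rewrite ey ex eqxx (negbTE ab) -sumv; lia.
    * by rewrite upd_same es.
    * by rewrite upd_same es /cm.
  + have i0 : i != ord0 by apply/eqP => e; apply: nz; rewrite -e.
    have i0' : ord0 != i by rewrite eq_sym.
    constructor 1; split; rewrite ?upd_other //.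
    rewrite es; apply: sync_base_upd => //; first by lia.
      by rewrite upd_other //; move: Ho; rewrite ey ex oth_a oth_b o; lia.
    by rewrite upd_other //; move: Hb; rewrite ey ex eqxx (negbTE ab) -sumv; lia.
  (* Role [i] has made all its moves, so by [A_early] only a and b are left, on which it is idle. *)
  + have i0 : i != ord0 by apply/eqP => e; apply: nz; rewrite -e z.
    move: Et; rewrite si2 idle0 // cnt_other0 // o.
    case: (posnP (cm (s ord0))) => // /(A_early HA) /(_ i0).
    by rewrite /cv z.
- have [base mu0 others vis] := HB; have [s2 s11 o sumv] := base.
  have [si2 vle] := s2 i.
  case: tri => [[m ox ey es]|[m u ex ey es]|[_ v ex ey es]|[z [t Et es]]].
  + have /cnt_eq0 /(_ k) : cnt other f = 0 by rewrite o /cm mu0.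
    by rewrite ox.
  + have i0 : i = ord0.
      by apply/eqP/negPn/negP => /s11; move: u; rewrite /cu => + E; rewrite E.
    by move: u; rewrite i0 /cu mu0.
  + have i0 : i = ord0.
      by apply/eqP/negPn/negP => i0; move: v; rewrite others.
    subst i; constructor 2; split.
    * rewrite es; apply: sync_base_upd => //; rewrite ?upd_same /cm /cu /cv /= -/(cv _).
      - by lia.
      - by move: Ho; rewrite ey ex oth_a oth_b o /cm mu0 /=; lia.
      by move: Hb; rewrite ey ex eqxx (negbTE ab) -sumv /cu mu0 /=; lia.
    * by rewrite upd_same es.
    * by move=> j j0; rewrite upd_other //; apply: others.
    * by move=> k'; rewrite /upd; case: eqP => [-> //|_]; apply: vis.
  + have i0 : i != ord0 by apply/eqP => e; move: pos; rewrite -e /cv z.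
    by move: Et; rewrite si2 idle0 // cnt_other0 // o /cm mu0.
- constructor 3; case: tri => [[]|[]|[]|[_ [t Et es]]]; rewrite /cm /cu /cv ?z //.
  split; first by move=> j; rewrite /upd; case: eqP => // _; rewrite es.
  have -> : (fun j => (upd s i s' j).2) = upd (fun j => (s j).2) i t.
    by apply: functional_extensionality => j; rewrite /upd; case: eqP => // _; rewrite es.
  exact: (Inv_step invP) Et.
Qed.

Lemma sync_stable_fin f s V : sync_Inv f s V ->
  (forall i k, sync_tr i (s i) (f k) = None) -> exists i, sync_fin (s i).
Proof.
move=> HI none; case/sync_Inv_cases: HI => [[HA nz]|[HB pos]|[z HI]].
- have [base vr uE] := HA; have [s2 s11 o sumv] := base.
  case: (posnP (cm (s ord0))) => [m0|m]; last first.
    have [k ok] : exists k, other (f k) by apply: cnt_gt0; rewrite o.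
    have := none ord0 k; move: m; rewrite /sync_tr /cm.
    by case: (s ord0) => [[[m u] v] t] /= ->; rewrite ok.
  case: (posnP (cu (s ord0))) => [u00|u].
    by case: nz; move: m0 u00; rewrite /cm /cu; case: (s ord0) => [[[m u] v] t] /= -> ->.
  have allb k : f k = b.
    have := none ord0 k; move: m0 u; rewrite /sync_tr /cm /cu.
    case: (s ord0) o => [[[m u] v] t] /= o m0 ->.
    rewrite m0 /=; case: eqP => // fa _; apply/eqP.
    by move: o; rewrite /cm /= m0 => /cnt_other0 /(_ k) /orP [/eqP|].
  (* With all [r] rooms in b and a -> b moves remaining, the sum of [cv] exceeds the leader's share
     [r]. *)
  have [i /andP [i0 vi]] : exists i, (i != ord0) && (0 < cv (s i)).
    apply: NNPP => no.
    have E : \sum_i cv (s i) = r.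
      rewrite (bigD1 ord0) //= big1 ?addn0 // => i i0.
      by case: (posnP (cv (s i))) => // vi; case: no; exists i; rewrite i0.
    by move: sumv; rewrite E num_all //; lia.
  have := none i (Ordinal r_gt0); rewrite allb; move: vi (s11 i i0); rewrite /cv.
  by case: (s i) => [[[m u'] v] t] /= v_gt0 [-> ->]; rewrite /= v_gt0 eqxx.
- have [base mu0 others vis] := HB; have [s2 s11 o sumv] := base.
  have [k fk] : exists k, f k = b.
    apply: num_gt0; have := le_sum1 (fun i => cv (s i)) ord0.
    by rewrite -sumv /cu mu0 /= addn0; apply: leq_trans.
  have := none ord0 k; rewrite fk; move: pos mu0; rewrite /cv.
  by case: (s ord0) => [[[m u'] v] t] /= v_gt0 [-> ->]; rewrite /= v_gt0 eqxx.
- have [|i fi] := stable_fin invP HI.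
    move=> i k; have := none i k; move: (z i); rewrite /sync_tr.
    by case: (s i) => [[[m u] v] t] /= [-> -> ->] /=; case: (tr _ _ _).
  by exists i; rewrite /sync_fin z eqxx.
Qed.

Lemma sync_fin_visited f s V i : sync_Inv f s V -> sync_fin (s i) -> forall j k, V j k.
Proof.
move=> HI /andP [_ fi].
case: HI => [[[s2 _ _ _] _ _]|[[s2 _ _ _] _ _ _]|[_ HI]].
- by have [E _] := s2 i; rewrite E fin0 in fi.
- by have [E _] := s2 i; rewrite E fin0 in fi.
exact: (fin_visited invP) HI fi.
Qed.

Lemma sync_Inv_init V : sync_Inv init sync_s0 V.
Proof.
constructor 1; split; rewrite /sync_s0 ?eqxx //; split.
- by move=> i; case: ifP; rewrite /cv /=.
- by move=> i /negPf ->.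
- by rewrite eqxx.
rewrite eqxx /cu /= /u0 subnKC; last by apply: leq_trans (num_le _ _) sum_v0_ge.
by apply: eq_bigr => i _; case: ifP.
Qed.

Lemma sync_invariant : progress_invariant sync_tr sync_fin sync_mu sync_Inv.
Proof.
split.
- exact: sync_mu_decr.
- exact: sync_Inv_mono.
- exact: sync_Inv_step.
- exact: sync_stable_fin.
exact: sync_fin_visited.
Qed.

Theorem sync_winning n : 0 < n <= N.+1 -> exists strat : strategy n q, winning init strat.
Proof.
case: n => // n /= nN.
(* Roles in excess of the prisoners all go to the last prisoner. *)
pose role_of (i : 'I_N.+1) : 'I_n.+1 := inord (minn i n).
exists (role_strategy sync_tr sync_s0 sync_fin a role_of).
apply: (role_strategy_winning a sync_invariant) => //; first exact: sync_Inv_init.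
move=> p; exists (widen_ord nN p); apply: val_inj; rewrite /role_of /=.
have /minn_idPl -> : p <= n by rewrite -ltnS.
exact: inordK.
Qed.

End Sync.

(** * At most two rooms: acknowledgments *)

Section Acknowledge.
Variables (N r q : nat) (a b c : 'I_q).
Hypotheses (ab : a != b) (ac : a != c) (bc : b != c).
Hypotheses (r_gt0 : 0 < r) (r_le2 : r <= 2).

(* The leader keeps the state c in one room [k0], the other one staying a.  Every
   other role waits for c and then (if there are two rooms) for a, hence has seen
   both rooms, and acknowledges by one move c -> b, which the leader counts and
   undoes. *)
Definition ack_tr (i : 'I_N.+1) (s : nat * nat) (x : 'I_q) : option (nat * nat * 'I_q) :=
  match i == ord0, s with
  | true, (0, _) => if x == a then Some ((4, N), c) else None
  | true, (4, v.+1) => if x == b then Some ((4, v), c) else None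
  | false, (0, _) => if x == c then Some ((if r == 1 then 2 else 1, 0), c) else None
  | false, (1, _) => if x == a then Some ((2, 0), a) else None
  | false, (2, _) => if x == c then Some ((3, 0), b) else None
  | _, _ => None
  end.

Definition ack_fin (s : nat * nat) := s == (4, 0).
(** The weight [N.+1] dominates the leader's counter, which starts at [N]. *)
Definition ack_mu (s : nat * nat) := (4 - s.1) * N.+1 + s.2.

Definition acked (s : 'I_N.+1 -> nat * nat) := \sum_i ((s i).1 == 3).

Definition ack_role r (k0 : 'I_r) (Vi : 'I_r -> Prop) j :=
  [/\ j <= 3, j = 1 -> r != 1, 0 < j -> Vi k0 & 1 < j -> forall k, Vi k].

(** In the last equation, the term [f k0 == b] stands for an acknowledgment that the leader has not
    yet counted. *)
Definition ack_Inv (f : 'I_r -> 'I_q) (s : 'I_N.+1 -> nat * nat) (V : 'I_N.+1 -> 'I_r -> Prop) :=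
  (forall k, V ord0 k) /\
  (((forall k, f k = a) /\ (forall i, s i = (0, 0))) \/
   exists k0, [/\ f k0 = b \/ f k0 = c, forall k, k != k0 -> f k = a,
     (s ord0).1 = 4, forall i, i != ord0 -> ack_role k0 (V i) (s i).1 &
     acked s + (s ord0).2 = N + (f k0 == b)]).

Lemma ack_mu_decr i s x s' y : ack_tr i s x = Some (s', y) -> ack_mu s' < ack_mu s.
Proof.
rewrite /ack_tr /ack_mu; case: s => j v.
case: (i == ord0).
  case: j => [|[|[|[|[|j]]]]] //; first by case: ifP => // _ [<- _] /=; lia.
  by case: v => // v; case: ifP => // _ [<- _] /=; lia.
case: j => [|[|[|j]]] //; case: ifP => // _ [<- _] /=; try lia.
by case: ifP => _ /=; lia.
Qed.

Lemma ack_Inv_step f s (V : 'I_N.+1 -> 'I_r -> Prop) i k s' y :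
  ack_Inv f s V -> V i k -> ack_tr i (s i) (f k) = Some (s', y) ->
  ack_Inv (upd f k y) (upd s i s') V.
Proof.
have ba : b == a = false by rewrite eq_sym (negbTE ab).
have ca : c == a = false by rewrite eq_sym (negbTE ac).
have cb : c == b = false by rewrite eq_sym (negbTE bc).
move=> [V0 H] Vik tri; split=> //.
case: H => [[fa s00]|[k0 [fk0 fa s04 roles cnt3]]].
  move: tri; rewrite /ack_tr s00 fa (negbTE ac) eqxx; case: eqP => // -> [<- <-].
  right; exists k; split.
  - by right; rewrite upd_same.
  - by move=> k' k'k; rewrite upd_other.
  - by rewrite upd_same.
  - by move=> j j0; rewrite upd_other // s00.
  rewrite /acked big1 ?upd_same ?cb ?addn0 //.
  by move=> j _; rewrite /upd; case: (j == _); rewrite ?s00.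
right; exists k0.
have E3 : acked (upd s i s') + ((s i).1 == 3) = acked s + (s'.1 == 3).
  exact: (sum_upd (fun t : nat * nat => ((t.1 == 3) : nat))).
have [i0|i0] := eqVneq i ord0.
  subst i; move: tri E3; rewrite /ack_tr eqxx.
  case E: (s ord0) => [j v]; move: (s04); rewrite E /= => ->.
  case: v E => // v E; case: eqP => // fk [<- <-] E3.
  have kk : k = k0 by apply/eqP/negPn/negP => /fa; rewrite fk => /eqP; rewrite ba.
  subst k; split; rewrite ?upd_same //.
  - by right.
  - by move=> k' k'k; rewrite upd_other // fa.
  - by move=> j' j'0; rewrite upd_other //; apply: roles.
  by move: cnt3 E3; rewrite E fk eqxx cb /=; lia.
have i0' : ord0 != i by rewrite eq_sym.
have [j3 j1 jk0 jk] := roles i i0.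
have kc : f k = c -> k = k0.
  by move=> fk; apply/eqP/negPn/negP => /fa; rewrite fk => /eqP; rewrite ca.
have others j' : ack_role k0 (V i) s'.1 -> j' != ord0 -> ack_role k0 (V j') (upd s i s' j').1.
  by move=> Hi j'0; rewrite /upd; case: eqP => [->|_] //; apply: roles.
move: tri; rewrite /ack_tr (negbTE i0); case E: (s i) j1 jk0 jk E3 => [[|[|[|j]]] v] //= j1 jk0 jk.
- move=> E3; case: eqP => // fk [Es Ey].
  have -> : upd f k y = f by rewrite -Ey -fk upd_id.
  have kk := kc fk; subst k.
  split; rewrite ?upd_other //; last by move: E3; rewrite -Es /=; case: (r == 1) => /=; lia.
  move=> j'; apply: others; rewrite -Es /=.
  split=> //; case: eqP => // r1 _ k.
  suff -> : k = k0 by [].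
  by apply: val_inj => /=; have := ltn_ord k; have := ltn_ord k0; lia.
- move=> E3; case: eqP => // fk [Es Ey].
  have -> : upd f k y = f by rewrite -Ey -fk upd_id.
  (* An a is seen only outside [k0], so with at most two rooms [k] and [k0] are all of them. *)
  have kk0 : k != k0.
    by apply/eqP => e; subst k; case: fk0; rewrite fk => /eqP; rewrite ?(negbTE ab) ?(negbTE ac).
  split; rewrite ?upd_other //; last by move: E3; rewrite -Es /=; lia.
  move=> j'; apply: others => //; rewrite -Es /=; split=> //.
  move=> _ k'; have := jk0 isT.
  have [->//|/eqP k'k0] := eqVneq k' k0; have [->//|/eqP k'k] := eqVneq k' k.
  have n (x z : 'I_r) : x <> z -> nat_of_ord x <> z by move=> H /val_inj.
  move: k'k0 k'k (elimN eqP kk0) => /n A /n B /n C.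
  by have := ltn_ord k; have := ltn_ord k0; have := ltn_ord k'; lia.
move=> E3; case: eqP => // fk [Es Ey]; have kk := kc fk; subst k y.
split; rewrite ?(@upd_other _ _ s) //.
- by left; rewrite upd_same.
- by move=> k' k'k; rewrite upd_other // fa.
- by move=> j'; apply: others => //; rewrite -Es /=; split=> // _; have := jk isT.
by move: E3 cnt3; rewrite upd_same fk eqxx cb -Es /=; lia.
Qed.

(** The leader is in state 4 and hence not counted, so [N] acknowledgments exhaust the other
    roles. *)
Lemma ack_nonleaders (s : 'I_N.+1 -> nat * nat) : (s ord0).1 = 4 -> acked s >= N ->
  forall i, i != ord0 -> (s i).1 = 3.
Proof.
move=> s04 le i i0; apply/eqP/negPn/negP => si.
have := le_sum2 (fun i => ((s i).1 != 3) : nat) i0; rewrite /= s04 si /=.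
have : \sum_i ((s i).1 != 3 : nat) + acked s = N.+1.
  rewrite /acked -big_split /= -[RHS]card_ord -sum1_card; apply: eq_bigr => j _.
  by case: (_ == 3).
move: (\sum_i _) => S; lia.
Qed.

Lemma ack_invariant : progress_invariant ack_tr ack_fin ack_mu ack_Inv.
Proof.
split.
- exact: ack_mu_decr.
- move=> f s V V' sub [V0 H]; split; first by move=> k; apply: sub.
  case: H => [H|[k0 [? ? ? roles ?]]]; [by left|right].
  exists k0; split=> // i /roles [? ? H1 H2]; split=> // [/H1 /sub //|/H2 H k].
  exact: sub.
- exact: ack_Inv_step.
- move=> f s V [V0 H] none.
  case: H => [[fa s00]|[k0 [fk0 fa s04 roles cnt3]]].
    by have := none ord0 (Ordinal r_gt0); rewrite /ack_tr s00 fa !eqxx.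
  exists ord0; rewrite /ack_fin; move: (none ord0 k0) cnt3; rewrite /ack_tr eqxx.
  case E: (s ord0) => [j v] /=; move: (s04); rewrite E /= => ->.
  case: v E => [|v] E //; case: eqP => // fkb _; case: fk0 => // fkc.
  suff : acked s = N by lia.
  have done i : i != ord0 -> (s i).1 = 3.
    move=> i0; have [j3 j1 _ _] := roles i i0.
    have := none i k0; rewrite /ack_tr (negbTE i0) fkc eqxx.
    case Ei: (s i) j3 j1 => [[|[|[|[|j']]]] v'] //= _ /(_ erefl) r1 _.
    (* A role in state 1 waits for a, which the second room shows; the index of that room is
       [1 - k0]. *)
    have [k kk0] : exists k, k != k0.
      have r2 : r = 2 by move: r1 r_gt0 r_le2; case: (r) => [|[|[|]]].
      have lt : 1 - k0 < r by lia.
      exists (Ordinal lt); rewrite -val_eqE /=; have := ltn_ord k0.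
      by apply/contraTneq => H; move: H; lia.
    by have := none i k; rewrite /ack_tr (negbTE i0) Ei /= fa // eqxx.
  rewrite /acked (bigD1 ord0) //= s04 /= (eq_bigr (fun=> 1)) => [|i /done -> //].
  rewrite sum1_card; have := cardC1 (@ord0 N); rewrite card_ord /= => H.
  by rewrite add0n; apply: etrans H; apply: eq_card => i; rewrite !inE.
- move=> f s V i [V0 H] /eqP si.
  case: H => [[fa s00]|[k0 [fk0 fa s04 roles cnt3]]]; first by move: si; rewrite s00.
  have i0 : i = ord0.
    by apply/eqP/negPn/negP => /roles []; rewrite si.
  move=> j k; have [->//|j0] := eqVneq j ord0.
  have [_ _ _ H] := roles j j0; apply: H.
  by rewrite (ack_nonleaders s04) //; move: cnt3; rewrite -i0 si /=; lia.
Qed.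

Theorem ack_winning n (init : 'I_r -> 'I_q) :
  0 < n <= N.+1 -> exists strat : strategy n q, winning init strat.
Proof.
apply: (sync_winning ab r_gt0 ack_invariant (s0 := fun=> (0, 0))) => //.
  by move=> f V fa V0; split=> //; left.
move=> i x /negPf i0; rewrite /ack_tr i0 => /orP [] /eqP ->.
  by rewrite (negbTE ac).
by rewrite (negbTE bc).
Qed.

End Acknowledge.

(** * At least three rooms: recognizing words *)

Section Words.
Variables (r q : nat) (a b c : 'I_q).
Hypotheses (ab : a != b) (ac : a != c) (bc : b != c).
Hypothesis r_gt2 : 2 < r.

Notation action := ('I_q * (nat * nat) * 'I_q)%type.

(* [word_rule i s = Some (g, s', y)]: in state [s], role [i] reacts to [g] only,
   by moving to [s'] and writing [y].  Role 1 waits for the word c, role 2 for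
   cbc and role 3 for cbcac. *)
Definition word_rule (i : nat) (s : nat * nat) : option action :=
  match i, s with
  | 0, (0, _) => Some (a, (1, 0), c)
  | 1, (0, _) => Some (c, (1, r.-1), b)
  | 1, (1, v.+1) => Some (a, (1, v), b)
  | 1, (1, 0) => Some (b, (2, 0), c)
  | 2, (0, _) => Some (c, (1, 0), c)
  | 2, (1, _) => Some (b, (2, 0), b)
  | 2, (2, _) => Some (c, (3, r.-1), a)
  | 2, (3, v.+1) => Some (b, (3, v), a)
  | 2, (3, 0) => Some (a, (4, 0), b)
  | 2, (4, _) => Some (a, (5, 0), c)
  | 3, (0, _) => Some (c, (1, 0), c)
  | 3, (1, _) => Some (b, (2, 0), b)
  | 3, (2, _) => Some (c, (3, 0), c)
  | 3, (3, _) => Some (a, (4, 0), a)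
  | 3, (4, _) => Some (c, (5, r.-2), c)
  | 3, (5, v) => Some (b, (6, v), c)
  | 3, (6, v.+1) => Some (a, (6, v), c)
  | _, _ => None
  end.

Definition word_tr (i : 'I_4) (s : nat * nat) (x : 'I_q) : option (nat * nat * 'I_q) :=
  if word_rule i s is Some (g, s', y) then if x == g then Some (s', y) else None else None.

Definition word_fin (s : nat * nat) := s == (6, 0).
(** The weight [r] exceeds every counter started by [word_rule], the largest being [r.-1]. *)
Definition word_mu (s : nat * nat) := (7 - s.1) * r + s.2.

Lemma word_mu_decr i s x s' y : word_tr i s x = Some (s', y) -> word_mu s' < word_mu s.
Proof.
rewrite /word_tr /word_mu; case: s => j v.
case: i => [[|[|[|[|i]]]] lt] //=.
- by case: j => [|j] //; case: ifP => // _ [<- _] /=; lia.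
- case: j => [|[|j]] //; first by case: ifP => // _ [<- _] /=; lia.
  by case: v => [|v]; case: ifP => // _ [<- _] /=; lia.
- case: j => [|[|[|[|[|j]]]]] //; try by case: ifP => // _ [<- _] /=; lia.
  by case: v => [|v]; case: ifP => // _ [<- _] /=; lia.
case: j => [|[|[|[|[|[|[|j]]]]]]] //; try by case: ifP => // _ [<- _] /=; lia.
by case: v => [|v] //; case: ifP => // _ [<- _] /=; lia.
Qed.

Lemma num_abc (f : 'I_r -> 'I_q) : num a f + num b f + num c f <= r.
Proof.
rewrite /num /cnt -!big_split /= -[r in _ <= r]card_ord -sum1_card.
apply: leq_sum => k _; have [->|] := eqVneq (f k) a; first by rewrite (negbTE ab) (negbTE ac).
have [->|] := eqVneq (f k) b; first by rewrite (negbTE bc).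
by case: (f k == c).
Qed.

Lemma num_pos (x : 'I_q) (f : 'I_r -> 'I_q) k : f k = x -> 0 < num x f.
Proof. by case: (posnP (num x f)) => // /num_eq0 /(_ k) /eqP. Qed.

Section Stage.
Variables (f : 'I_r -> 'I_q) (V1 V2 V3 : 'I_r -> Prop).

(* The bounds on [p2.1] and [p3.1] say how long a prefix of its word a passive
   role can have read: each stage lacks the letter that would come next. *)
Variant stage (p0 p1 p2 p3 : nat * nat) : Prop :=
| AllA of [/\ p0.1 = 0, p1.1 = 0, p2.1 = 0 & p3.1 = 0] & num a f = r
| ShowAC of [/\ p0.1 = 1, p1.1 = 0, p2.1 <= 1 & p3.1 <= 1] & num c f = 1 & num a f + 1 = r
| Visit1 of [/\ p0.1 = 1, p1.1 = 1, p2.1 <= 2 & p3.1 <= 2] &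
    num a f = p1.2 & num a f + num b f = r & (forall k, f k = b -> V1 k)
| ShowBC of [/\ p0.1 = 1, p1.1 = 2, p2.1 <= 2 & p3.1 <= 3] &
    num c f = 1 & num b f + 1 = r & (forall k, V1 k)
| Visit2 of [/\ p0.1 = 1, p1.1 = 2, p2.1 = 3 & p3.1 <= 4] &
    num b f = p2.2 & num a f + num b f = r & (forall k, V1 k) & (forall k, f k = a -> V2 k)
| OneB of [/\ p0.1 = 1, p1.1 = 2, p2.1 = 4 & p3.1 <= 4] &
    num b f = 1 & num a f + 1 = r & (forall k, V1 k) & (forall k, V2 k)
| ShowABC of [/\ p0.1 = 1, p1.1 = 2, p2.1 = 5 & p3.1 <= 4] &
    [/\ num b f = 1, num c f = 1 & num a f + 2 = r] & (forall k, V1 k) & (forall k, V2 k)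
| Start3 of [/\ p0.1 = 1, p1.1 = 2, p2.1 = 5 & p3.1 = 5] &
    [/\ num b f = 1, num c f = 1, num a f + 2 = r & num a f = p3.2] &
    (forall k, V1 k) & (forall k, V2 k) & (forall k, f k = c -> V3 k)
| Visit3 of [/\ p0.1 = 1, p1.1 = 2, p2.1 = 5 & p3.1 = 6] &
    num a f = p3.2 & num a f + num c f = r &
    (forall k, V1 k) & (forall k, V2 k) & (forall k, f k = c -> V3 k).

End Stage.

Lemma letters : ((a == b) = false) * ((a == c) = false) * ((b == c) = false) *
  ((b == a) = false) * ((c == a) = false) * ((c == b) = false).
Proof.
by rewrite [b == a]eq_sym [c == a]eq_sym [c == b]eq_sym (negbTE ab) (negbTE ac) (negbTE bc).
Qed.

Lemma num_unique (x : 'I_q) (f : 'I_r -> 'I_q) k k' :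
  num x f = 1 -> f k = x -> f k' = x -> k' = k.
Proof.
move=> n1 fk fk'; apply/eqP/negPn/negP => /(le_sum2 (fun k => (f k == x) : nat)).
by rewrite fk fk' eqxx -/(num x f) -[\sum_k _]/(num x f) n1.
Qed.

Section Steps.
Variables (f : 'I_r -> 'I_q) (V1 V2 V3 : 'I_r -> Prop) (k : 'I_r).
Variables (p0 p1 p2 p3 : nat * nat).
Hypothesis st : stage f V1 V2 V3 p0 p1 p2 p3.

(** [count_letters] collects the changes of the three counts; with them [lia] in [split_stage]
    refutes every stage that lacks the letter read or does not fit the state of the role. *)
Ltac count_letters fk y :=
  have := num_abc f; have := num_pos (esym fk);
  have := num_upd a f k y; have := num_upd b f k y; have := num_upd c f k y;
  rewrite -fk ?eqxx ?letters.
Ltac split_stage s := case: s => [[]|[]|[]|[]|[]|[]|[] + + + + []|[] + + + + []|[]]; simpl; try lia.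
Ltac arith := by [split=> //=; lia|simpl; lia].

Lemma visit_upd (x : 'I_q) (V : 'I_r -> Prop) : V k ->
  (forall k', f k' = x -> V k') -> forall k', upd f k x k' = x -> V k'.
Proof. by move=> Vk H k'; rewrite /upd; case: eqP => [->|_ /H]. Qed.

Lemma stage_step0 p y : word_rule 0 p0 = Some (f k, p, y) ->
  stage (upd f k y) V1 V2 V3 p p1 p2 p3.
Proof.
case: p0 st => [[|j] v] //= s [fk <- <-]; count_letters fk c.
split_stage s => *; apply: ShowAC; arith.
Qed.

(** The first move uses up the only c and leaves [r.-1] rooms in a. From then on the counter equals
    the number of a's, and at zero the role has been everywhere. *)
Lemma stage_step1 p y : V1 k -> word_rule 1 p1 = Some (f k, p, y) ->
  stage (upd f k y) V1 V2 V3 p0 p p2 p3.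
Proof.
move=> V1k; case: p1 st => [[|[|j]] v] //= s.
- move=> [fk <- <-]; count_letters fk b; split_stage s => *.
  apply: Visit1; try arith; apply: visit_upd => // k' fk'.
  by have := num_pos fk'; lia.
case: v s => [|v] s [fk <- <-].
  count_letters fk c; split_stage s => *; apply: ShowBC; try arith.
  have /num_full fb : num b f = r by lia.
  by move=> k'; auto.
count_letters fk b; split_stage s => *; apply: Visit1; try arith.
exact: visit_upd.
Qed.

(** The first two letters are read without changing any room. The second c can only be met in
    [ShowBC], since the bound in [ShowAC] allows just one letter to have been read. *)
Lemma stage_step2 p y : V2 k -> word_rule 2 p2 = Some (f k, p, y) ->
  stage (upd f k y) V1 V2 V3 p0 p1 p p3.
Proof.
move=> V2k; case: p2 st => [[|[|[|[|[|j]]]]] v] //= s.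
- move=> [fk <- <-]; count_letters fk c; rewrite fk upd_id; split_stage s => *.
  + by apply: ShowAC; arith.
  + by apply: ShowBC => //; arith.
- move=> [fk <- <-]; count_letters fk b; rewrite fk upd_id; split_stage s => *.
  + by apply: Visit1 => //; arith.
  + by apply: ShowBC => //; arith.
- move=> [fk <- <-]; count_letters fk a; split_stage s => *.
  apply: Visit2 => //; try arith; apply: visit_upd => // k' fk'.
  by have := num_pos fk'; lia.
- case: v s => [|v] s [fk <- <-].
    count_letters fk b; split_stage s => *; apply: OneB => //; try arith.
    have /num_full fa : num a f = r by lia.
    by move=> k'; auto.
  count_letters fk a; split_stage s => *; apply: Visit2 => //; try arith.
  exact: visit_upd.
move=> [fk <- <-]; count_letters fk c; split_stage s => *.
by apply: ShowABC => //; arith.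
Qed.

(** Five letters are read without changing any room. The last c singles out [ShowABC], with [r.-2]
    rooms in a; its room is the only one in c, hence the one being visited. *)
Lemma stage_step3 p y : V3 k -> word_rule 3 p3 = Some (f k, p, y) ->
  stage (upd f k y) V1 V2 V3 p0 p1 p2 p.
Proof.
move=> V3k; case: p3 st => [[|[|[|[|[|[|[|j]]]]]]] v] //= s.
- move=> [fk <- <-]; count_letters fk c; rewrite fk upd_id; split_stage s => *.
  + by apply: ShowAC => //; arith.
  + by apply: ShowBC => //; arith.
  + by apply: ShowABC => //; arith.
- move=> [fk <- <-]; count_letters fk b; rewrite fk upd_id; split_stage s => *.
  + by apply: Visit1 => //; arith.
  + by apply: ShowBC => //; arith.
  + by apply: Visit2 => //; arith.
  + by apply: OneB => //; arith.
  + by apply: ShowABC => //; arith.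
- move=> [fk <- <-]; count_letters fk c; rewrite fk upd_id; split_stage s => *.
  + by apply: ShowBC => //; arith.
  + by apply: ShowABC => //; arith.
- move=> [fk <- <-]; count_letters fk a; rewrite fk upd_id; split_stage s => *.
  + by apply: Visit2 => //; arith.
  + by apply: OneB => //; arith.
  + by apply: ShowABC => //; arith.
- move=> [fk <- <-]; count_letters fk c; rewrite fk upd_id; split_stage s => *.
  apply: Start3 => //; try arith.
  by move=> k' fk'; rewrite (num_unique _ (esym fk) fk').
- move=> [fk <- <-]; count_letters fk c; split_stage s => *.
  by apply: Visit3 => //; try arith; apply: visit_upd.
case: v s => [|v] s // [fk <- <-]; count_letters fk c; split_stage s => *.
by apply: Visit3 => //; try arith; apply: visit_upd.
Qed.

End Steps.

(** * From the stages to the invariant of the four-role protocol *)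

Let R1 : 'I_4 := @Ordinal 4 1 isT.
Let R2 : 'I_4 := @Ordinal 4 2 isT.
Let R3 : 'I_4 := @Ordinal 4 3 isT.

Lemma ord4_ind (P : 'I_4 -> Prop) : P ord0 -> P R1 -> P R2 -> P R3 -> forall i, P i.
Proof.
have E (i j : 'I_4) : val i = val j -> P j -> P i by move=> /val_inj ->.
by move=> P0 P1 P2 P3 [[|[|[|[|//]]]] lt]; [move: P0|move: P1|move: P2|move: P3]; apply: E.
Qed.

(** Role 0 has been everywhere since the synchronization, so the stages record only the visits of
    the other roles. *)
Definition word_Inv (f : 'I_r -> 'I_q) (s : 'I_4 -> nat * nat) (V : 'I_4 -> 'I_r -> Prop) :=
  (forall k, V ord0 k) /\
  stage f (V R1) (V R2) (V R3) (s ord0) (s R1) (s R2) (s R3).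

Lemma word_Inv_step f s (V : 'I_4 -> 'I_r -> Prop) i k s' y :
  word_Inv f s V -> V i k -> word_tr i (s i) (f k) = Some (s', y) ->
  word_Inv (upd f k y) (upd s i s') V.
Proof.
move=> [V0 st] Vik; rewrite /word_tr.
case E: (word_rule _ _) => [[[g s''] y']|] //; case: eqP => // fk [ss yy].
subst s'' y' g; split=> //; move: i Vik E.
apply: ord4_ind => Vk E.
- by have := stage_step0 st E; rewrite /upd.
- by have := stage_step1 st Vk E; rewrite /upd.
- by have := stage_step2 st Vk E; rewrite /upd.
by have := stage_step3 st Vk E; rewrite /upd.
Qed.

Lemma stage_mono f (V1 V2 V3 V1' V2' V3' : 'I_r -> Prop) p0 p1 p2 p3 :
  (forall k, V1 k -> V1' k) -> (forall k, V2 k -> V2' k) -> (forall k, V3 k -> V3' k) ->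
  stage f V1 V2 V3 p0 p1 p2 p3 -> stage f V1' V2' V3' p0 p1 p2 p3.
Proof.
move=> H1 H2 H3 [] *.
- exact: AllA.
- exact: ShowAC.
- by apply: Visit1; auto.
- by apply: ShowBC; auto.
- by apply: Visit2; auto.
- by apply: OneB; auto.
- by apply: ShowABC; auto.
- by apply: Start3; auto.
by apply: Visit3; auto.
Qed.

(** In each stage the role in charge waits for a letter that is present, whatever prefix it has
    read; [r_gt2] provides the a in [ShowABC]. Only [Visit3] with counter zero is stuck, and there
    role 3 has finished. *)
Lemma word_stable_fin f s V : word_Inv f s V ->
  (forall i k, word_tr i (s i) (f k) = None) -> exists i, word_fin (s i).
Proof.
move=> [_ st] none.
have guard (i : 'I_4) g s' y : word_rule i (s i) = Some (g, s', y) -> num g f = 0.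
  move=> E; case: (posnP (num g f)) => // /num_gt0 [k fk].
  by have := none i k; rewrite /word_tr E fk eqxx.
have {guard} [G0 G1 G2 G3] := And4 (guard ord0) (guard R1) (guard R2) (guard R3).
exists R3; rewrite /word_fin; move: st G0 G1 G2 G3; have := num_abc f.
case: (s ord0) (s R1) (s R2) (s R3) => [j0 v0] [j1 v1] [j2 v2] [j3 v3] n_le st G0 G1 G2 G3.
case: st => /= [[] e0 e1 e2 e3|[] e0 e1 e2 e3|[] e0 e1 e2 e3|[] e0 e1 e2 e3|[] e0 e1 e2 e3
  |[] e0 e1 e2 e3|[] e0 e1 e2 e3 []|[] e0 e1 e2 e3 []|[] e0 e1 e2 e3]; subst.
- by have := G0 _ _ _ erefl; lia.
- by have := G1 _ _ _ erefl; lia.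
- by case: v1 G1 => [|v] /(_ _ _ _ erefl); lia.
- by case: j2 e2 G2 => [|[|[|]]] // _ /(_ _ _ _ erefl); lia.
- by case: v2 G2 => [|v] /(_ _ _ _ erefl); lia.
- by have := G2 _ _ _ erefl; lia.
- by case: j3 e3 G3 => [|[|[|[|[|]]]]] // _ /(_ _ _ _ erefl); lia.
- by have := G3 _ _ _ erefl; lia.
by case: v3 G3 => [|v] // /(_ _ _ _ erefl); lia.
Qed.

Lemma word_fin_visited f s V i : word_Inv f s V -> word_fin (s i) -> forall j k, V j k.
Proof.
move=> [V0 st] fi.
(* No other role reaches state 6, so the finished role is role 3. *)
have [e6 full] : (s R3).1 = 6 /\ (s R3).2 = 0.
  move: i fi; apply: ord4_ind => /eqP e; rewrite ?e //; move: st; rewrite e.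
  - by case=> [[]|[]|[]|[]|[]|[]|[]|[]|[]] //=.
  - by case=> [[]|[]|[]|[]|[]|[]|[]|[]|[]] //=.
  by case=> [[]|[]|[]|[]|[]|[]|[]|[]|[]] //=.
apply: ord4_ind => k; first exact: V0;
  case: st e6 full => [[]|[]|[]|[]|[]|[]|[] ? ? ? ? []|[] ? ? ? ? []|[]]; try lia; auto.
move=> _ _ _ _ na nc _ _ vis _ v_0; apply: vis; apply: num_full; lia.
Qed.

Lemma word_invariant : progress_invariant word_tr word_fin word_mu word_Inv.
Proof.
split.
- exact: word_mu_decr.
- move=> f s V V' sub [V0 st]; split; first by move=> k; apply: sub.
  by apply: stage_mono st => k; apply: sub.
- exact: word_Inv_step.
- exact: word_stable_fin.
exact: word_fin_visited.
Qed.

Theorem word_winning n (init : 'I_r -> 'I_q) :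
  0 < n <= 4 -> exists strat : strategy n q, winning init strat.
Proof.
have r_gt0 : 0 < r by lia.
apply: (sync_winning ab r_gt0 word_invariant (s0 := fun=> (0, 0))) => //.
  by move=> f V fa V0; split=> //; apply: AllA => //; apply: num_all.
apply: ord4_ind => x // _ /orP [] /eqP ->; rewrite /word_tr /= ?letters //.
Qed.

End Words.

(** * Choice of the protocol by the number of rooms *)

Theorem mainTheorem4 (n r q : nat) :
  n <= 4 -> 1 <= r -> 3 <= q ->
  forall init : 'I_r -> 'I_q, exists strat : strategy n q, winning init strat.
Proof.
case: n => [|n] n4 r1 q3 init.
  (* Without prisoners there is no schedule at all. *)
  have strat : strategy 0 q by case.
  by exists strat => sched _; case: (sched 0) => [[]].
pose a := Ordinal (leq_trans (isT : 0 < 3) q3).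
pose b := Ordinal (leq_trans (isT : 1 < 3) q3).
pose c := Ordinal (leq_trans (isT : 2 < 3) q3).
case: (leqP r 2) => r2.
  (* The argument [3] counts the roles besides the leader. *)
  by apply: (@ack_winning 3 r q a b c).
by apply: (@word_winning r q a b c).
Qed.
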